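(* There is an algorithm that, for any graph $G$ on $n$ vertices that has minimum degree $\delta$, produces a burning sequence (burning all vertices of $G$) with length at most $\left\lceil \sqrt{\frac{24n}{\delta+1}}\ \right\rceil$.
   Context: Graphs are finite, simple, undirected and unweighted; $d(u,v)$ denotes the length of a shortest path between $u$ and $v$. Burning process: it takes place in synchronous rounds $1,2,\dots$. In each round $i$, every vertex having a neighbour that was burned in an earlier round becomes burned, and additionally one chosen vertex $a_i$ (the activator of round $i$) becomes burned; burned vertices stay burned. A burning sequence (specified by a burning schedule) of length $m$ is a sequence $\langle a_1,\dots,a_m\rangle$ of activators, where $a_i$ is the activator of round $i$; it burns $G$ (completes in $m$ rounds) if all vertices are burned by the end of round $m$, equivalently if every vertex $v$ satisfies $d(v,a_i)\le m-i$ for some $i\in\{1,\dots,m\}$. The degree of a vertex is the number of edges incident to it, and the minimum degree of $G$ is the minimum vertex degree taken over all vertices of $G$.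
   Formalization: The graph G is additionally assumed to be connected (and non-empty); without connectedness the claim fails, e.g. for 26 isolated vertices, which need 26 rounds while the bound is 25. *)

(* Defs.v *)
From HB Require Import structures.
From mathcomp Require Import all_boot all_order all_algebra.
From mathcomp Require Import reals.

Set Implicit Arguments.
Unset Strict Implicit.
Unset Printing Implicit Defensive.

(** A finite simple graph with [n] vertices is a symmetric irreflexive relation
    on ['I_n]. *)

Definition degree (n : nat) (e : rel 'I_n) (v : 'I_n) : nat := #|[set u | e v u]|.

Definition is_min_degree (n : nat) (e : rel 'I_n) (delta : nat) : Prop :=
  (exists v, degree e v = delta) /\ (forall v, delta <= degree e v).

Definition connected_graph (n : nat) (e : rel 'I_n) : Prop :=
  0 < n /\ forall u v, connect e u v.

(** [B] is the set of vertices burned before the round, [a] is the activator of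
    the round. *)
Definition burn_round (n : nat) (e : rel 'I_n) (B : {set 'I_n}) (a : 'I_n) :
    {set 'I_n} :=
  B :|: [set v | [exists u in B, e u v]] :|: [set a].

Definition burned (n : nat) (e : rel 'I_n) (s : seq 'I_n) : {set 'I_n} :=
  foldl (burn_round e) set0 s.

Definition burning_sequence (n : nat) (e : rel 'I_n) (s : seq 'I_n) : Prop :=
  burned e s = [set: 'I_n].

(** An arbitrary Rocq function need not be computable once choice axioms are
    available, so "algorithm" is made precise by a standard Turing-complete
    model: the WHILE language of N. D. Jones (Computability and Complexity from
    a Programming Perspective), whose data are binary trees with a single
    atom, with [Skip] and [If] (definable there) taken as primitive. *)

Inductive data : Type := Nil | Cons of data & data.

Fixpoint data_eqb (d1 d2 : data) : bool :=
  match d1, d2 with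
  | Nil, Nil => true
  | Cons a1 b1, Cons a2 b2 => data_eqb a1 a2 && data_eqb b1 b2
  | _, _ => false
  end.

Definition hd (d : data) : data := if d is Cons a _ then a else Nil.
Definition tl (d : data) : data := if d is Cons _ b then b else Nil.

Definition data_bool (b : bool) : data := if b then Cons Nil Nil else Nil.
Definition truthy (d : data) : bool := if d is Cons _ _ then true else false.

Inductive expr : Type :=
  | Var of nat
  | Const of data
  | ConsE of expr & expr
  | Hd of expr
  | Tl of expr
  | EqE of expr & expr.

Inductive cmd : Type :=
  | Skip
  | Assign of nat & expr
  | Seq of cmd & cmd
  | If of expr & cmd & cmd
  | While of expr & cmd.

Definition store : Type := nat -> data.

Definition update (st : store) (x : nat) (d : data) : store :=
  fun y => if y == x then d else st y.

Fixpoint eval (st : store) (E : expr) : data :=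
  match E with
  | Var x => st x
  | Const d => d
  | ConsE E1 E2 => Cons (eval st E1) (eval st E2)
  | Hd E1 => hd (eval st E1)
  | Tl E1 => tl (eval st E1)
  | EqE E1 E2 => data_bool (data_eqb (eval st E1) (eval st E2))
  end.

(** Big-step semantics: [exec C st st'] includes termination of [C]. *)
Inductive exec : cmd -> store -> store -> Prop :=
  | exec_skip st : exec Skip st st
  | exec_assign st x E : exec (Assign x E) st (update st x (eval st E))
  | exec_seq C1 C2 st1 st2 st3 :
      exec C1 st1 st2 -> exec C2 st2 st3 -> exec (Seq C1 C2) st1 st3
  | exec_if_true E C1 C2 st st' :
      truthy (eval st E) -> exec C1 st st' -> exec (If E C1 C2) st st'
  | exec_if_false E C1 C2 st st' :
      ~~ truthy (eval st E) -> exec C2 st st' -> exec (If E C1 C2) st st'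
  | exec_while_false E C st :
      ~~ truthy (eval st E) -> exec (While E C) st st
  | exec_while_true E C st1 st2 st3 :
      truthy (eval st1 E) -> exec C st1 st2 -> exec (While E C) st2 st3 ->
      exec (While E C) st1 st3.

(** The input is read from, and the output left in, variable [0]; all other
    variables initially hold [Nil]. *)
Definition outputs (C : cmd) (input output : data) : Prop :=
  exists2 st, exec C (update (fun _ => Nil) 0 input) st & st 0 = output.

Lemma exec_deterministic C st st1 st2 :
  exec C st st1 -> exec C st st2 -> st1 = st2.
Proof.
move=> H; elim: H st2 => {C st st1}.
- by move=> st st2 H; inversion H.
- by move=> st x E st2 H; inversion H.
- move=> C1 C2 sa sb sc _ IH1 _ IH2 st2 H; inversion H; subst.
  by apply: IH2; rewrite (IH1 _ H2).
- move=> E C1 C2 sa sb t _ IH st2 H; inversion H; subst; first exact: IH.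
  by rewrite t in H5.
- move=> E C1 C2 sa sb t _ IH st2 H; inversion H; subst; last exact: IH.
  by rewrite H5 in t.
- move=> E C sa t st2 H; inversion H; subst => //.
  by rewrite H2 in t.
- move=> E C sa sb sc t _ IH1 _ IH2 st2 H; inversion H; subst.
    by rewrite t in H4.
  by apply: IH2; rewrite (IH1 _ H3).
Qed.

(** A graph is given by its adjacency matrix (a list of rows of booleans), and a
    vertex [i] is represented by the unary numeral [i]. *)

Definition data_nat (k : nat) : data := iter k (Cons Nil) Nil.

Definition data_list (s : seq data) : data := foldr Cons Nil s.

Definition data_graph (n : nat) (e : rel 'I_n) : data :=
  data_list [seq data_list [seq data_bool (e i j) | j <- enum 'I_n]
            | i <- enum 'I_n].

Definition data_vertices (n : nat) (s : seq 'I_n) : data :=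
  data_list [seq data_nat (val i) | i <- s].

(* Main.v *)
Require Import Defs.
From mathcomp Require Import all_boot all_order all_algebra.
From mathcomp Require Import reals zify.

Set Implicit Arguments.
Unset Strict Implicit.
Unset Printing Implicit Defensive.

(* [Cons] and [Nil] would otherwise denote the constructors of [seq]. *)
Import Defs.
Import Order.TTheory GRing.Theory Num.Theory.

(** The algorithm is an exhaustive search for a shortest burning sequence, so the
    bound only has to be proved for some burning sequence.  Let [k] be such that
    [24 n <= k ^ 2 (delta + 1)] and take a maximal set [C] of vertices at pairwise
    distance more than [r = 6 q + 2].  Every vertex is within distance [r] of [C],
    so activating [C] first and then waiting [r] rounds burns the graph in
    [#|C| + r] rounds.  If [C] has at least two elements, the balls of radius
    [3 q + 1] around them are disjoint, and each contains the disjoint closed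
    neighbourhoods of vertices at distance 0, 3, ..., [3 q] from its centre, hence
    has at least [(q + 1) (delta + 1)] vertices.  This bounds [#|C|], and a choice
    of [q] near [k / 12] makes [#|C| + r <= k].

    The search is a program of a small first-order language whose only iteration
    is folding over lists, compiled to WHILE, run inside one unbounded loop. *)

(** * Packing balls in a graph *)

Section Balls.

Variables (n : nat) (e : rel 'I_n).

Definition expand (B : {set 'I_n}) : {set 'I_n} :=
  B :|: [set v | [exists u in B, e u v]].

Definition ball (r : nat) (v : 'I_n) : {set 'I_n} := iter r expand [set v].

Lemma expandP (B : {set 'I_n}) x :
  reflect (exists2 u, u \in B & (u == x) || e u x) (x \in expand B).
Proof.
rewrite !inE; apply: (iffP orP) => [[xB|/existsP[u /andP[uB eux]]]|[u uB]].
- by exists x; rewrite ?eqxx.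
- by exists u; rewrite ?eux ?orbT.
- case/orP=> [/eqP<-|eux]; first by left.
  by right; apply/existsP; exists u; rewrite uB.
Qed.

Lemma expandS (A B : {set 'I_n}) : A \subset B -> expand A \subset expand B.
Proof.
move=> /subsetP sAB; apply/subsetP=> x /expandP[u uA ux].
by apply/expandP; exists u; rewrite ?sAB.
Qed.

Lemma iter_expandS r (A B : {set 'I_n}) :
  A \subset B -> iter r expand A \subset iter r expand B.
Proof. by move=> sAB; elim: r => //= r; apply: expandS. Qed.

Lemma ball_leq r t v : r <= t -> ball r v \subset ball t v.
Proof.
move=> /subnK<-; elim: (t - r) => //= d IH.
by apply: subset_trans IH _; apply: subsetUl.
Qed.

Lemma mem_ball0 r v : v \in ball r v.
Proof. by apply: (subsetP (ball_leq v (leq0n r))); rewrite inE. Qed.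

Lemma ball_edge u v : e u v -> v \in ball 1 u.
Proof. by move=> euv; apply/expandP; exists u; rewrite ?inE ?euv ?orbT. Qed.

Lemma ball_trans r t u v w :
  v \in ball r u -> w \in ball t v -> w \in ball (t + r) u.
Proof.
rewrite /ball iterD => vu; apply/subsetP/iter_expandS.
by rewrite sub1set.
Qed.

Hypothesis e_sym : symmetric e.

Lemma ball_sym r u v : (v \in ball r u) = (u \in ball r v).
Proof.
suff: forall x y, x \in ball r y -> y \in ball r x by move=> H; apply/idP/idP; apply: H.
elim: r => [|r IH] x y; first by rewrite !inE eq_sym.
case/expandP=> w /IH yw wx; rewrite -addn1; apply: ball_trans yw.
by case/orP: wx => [/eqP->|]; [apply: mem_ball0 | rewrite e_sym; apply: ball_edge].
Qed.

Lemma expand_fixed (B : {set 'I_n}) u v :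
  connect e u v -> expand B \subset B -> u \in B -> v \in B.
Proof.
move=> /connectP[p + ->] sB; elim: p u => //= x p IH u /andP[eux pth] uB.
by apply: IH pth _; apply: (subsetP sB); apply/expandP; exists u; rewrite ?eux ?orbT.
Qed.

(** Round [size s1 + 1] burns [a] itself, and each of the [size s2] later rounds burns at least what
    [expand] adds. *)
Lemma burned_ball s1 a s2 : ball (size s2) a \subset burned e (s1 ++ a :: s2).
Proof.
rewrite /burned foldl_cat /=; set B := burn_round _ _ _.
have: [set a] \subset B by apply: subsetUr.
rewrite /ball; elim: s2 B [set a] => //= b s2 IH B A sAB.
rewrite -iterS iterSr; apply: IH; apply: subset_trans (expandS sAB) _.
by apply: subsetUl.
Qed.

Hypotheses (e_irr : irreflexive e) (e_conn : connected_graph e).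

Variable delta : nat.
Hypothesis e_deg : forall v, delta <= degree e v.

Lemma card_ball1 v : delta < #|ball 1 v|.
Proof.
have sub: v |: [set u | e v u] \subset ball 1 v.
  by rewrite subUset sub1set mem_ball0; apply/subsetP=> u; rewrite inE; apply: ball_edge.
apply: leq_trans (subset_leq_card sub).
by rewrite cardsU1 inE e_irr add1n ltnS; apply: e_deg.
Qed.

(** A ball that stops growing is closed under edges, so by connectivity it would contain [w]. *)
Lemma ball_sphere r v w : w \notin ball r v -> exists2 x, x \in ball r.+1 v & x \notin ball r v.
Proof.
move=> nw; apply/subsetPn; apply: contra nw => sB.
by apply: expand_fixed sB (mem_ball0 r v); apply: e_conn.2.
Qed.

(* A vertex [x] at distance exactly [3 q + 3] from [v] contributes its closed
   neighbourhood, which lies in [ball (3 q + 4) v] and misses [ball (3 q + 1) v]. *)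
Lemma card_ball q v w :
  w \notin ball (3 * q).+1 v -> q.+1 * delta.+1 <= #|ball (3 * q).+1 v|.
Proof.
elim: q => [|q IH] nw; first by rewrite mul1n; apply: card_ball1.
have E : (3 * q.+1).+1 = (3 * q).+4 by lia.
rewrite E in nw *.
have [x x3 x2] : exists2 x, x \in ball (3 * q).+3 v & x \notin ball (3 * q).+2 v.
  by apply: (@ball_sphere _ _ w); apply: contra nw; apply/subsetP/ball_leq; lia.
have dis : [disjoint ball 1 x & ball (3 * q).+1 v].
  rewrite disjoint_subset; apply/subsetP=> y yx; rewrite inE; apply: contra x2 => yv.
  by rewrite -add1n; apply: ball_trans yv _; rewrite ball_sym.
have sub : ball 1 x :|: ball (3 * q).+1 v \subset ball (3 * q).+4 v.
  rewrite subUset ball_leq ?andbT; last by lia.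
  by apply/subsetP=> y; rewrite -[X in ball X v]add1n; apply: ball_trans.
apply: leq_trans (subset_leq_card sub).
rewrite cardsU disjoint_setI0 // cards0 subn0 mulSn leq_add ?card_ball1 ?IH //.
by apply: contra nw; apply/subsetP/ball_leq; lia.
Qed.

(** Double counting: after exchanging the sums, each vertex contributes at most 1, since it lies in
    [F c] for at most one [c]. *)
Lemma sum_card_disjoint (T : finType) (C : {set T}) (F : T -> {set 'I_n}) :
  {in C &, forall c d x, x \in F c -> x \in F d -> c = d} ->
  \sum_(c in C) #|F c| <= n.
Proof.
move=> dis; under eq_bigr do rewrite -sum1_card big_mkcond.
rewrite exchange_big -[leqRHS]card_ord -sum1_card leq_sum // => x _.
rewrite -big_mkcondr sum1_card; apply/card_le1P => c.
rewrite unfold_in => /andP[cC xc] d; rewrite unfold_in inE; apply/idP/eqP => [/andP[dC xd]|->].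
  exact: dis xd xc.
exact/andP.
Qed.

Definition separated r (C : {set 'I_n}) :=
  [forall c in C, forall d in C, (d \in ball r c) ==> (c == d)].

Lemma separatedP r (C : {set 'I_n}) :
  reflect {in C &, forall c d, d \in ball r c -> c = d} (separated r C).
Proof.
apply: (iffP forall_inP) => [H c d cC dC dc|H c cC].
  by move/forall_inP: (H c cC) => /(_ d dC)/implyP/(_ dc)/eqP.
by apply/forall_inP=> d dC; apply/implyP=> dc; apply/eqP/H.
Qed.

Lemma separated_cover r :
  exists2 C, separated r C & forall v, exists2 c, c \in C & v \in ball r c.
Proof.
have sep0 : separated r set0 by apply/separatedP=> c; rewrite inE.
have [C /maxsetP[sepC maxC] _] := maxset_exists sep0.
exists C => // v; case: (boolP [exists c in C, v \in ball r c]) => [/exists_inP//|].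
move/exists_inPn => far; exists v; last exact: mem_ball0.
suff /maxC <- : separated r (v |: C) by rewrite ?setU11 ?subsetUr.
apply/separatedP=> c d /setU1P[->|cC] /setU1P[->|dC] //.
- by rewrite ball_sym => vd; case/negP: (far d dC).
- by move=> vc; case/negP: (far c cC).
- exact: (separatedP _ _ sepC).
Qed.

Lemma separated_card q C :
  separated (6 * q).+2 C -> 1 < #|C| -> #|C| * (q.+1 * delta.+1) <= n.
Proof.
move=> /separatedP sep C2; rewrite -sum_nat_const.
apply: leq_trans (sum_card_disjoint (C := C) (F := ball (3 * q).+1) _); last first.
  move=> c d cC dC x xc xd; apply: sep => //; rewrite ball_sym in xd.
  have -> : (6 * q).+2 = (3 * q).+1 + (3 * q).+1 by lia.
  exact: ball_trans xc xd.
(* Another centre [d] serves as the vertex outside the ball around [c] that [card_ball] requires. *)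
apply: leq_sum => c cC; have [d dC ncd] : exists2 d, d \in C & d != c.
  have: 0 < #|C :\ c| by move: C2; rewrite (cardsD1 c) cC.
  by case/card_gt0P=> d /setD1P[]; exists d.
apply: (@card_ball _ _ d); apply/negP=> dc; case/eqP: ncd; apply/esym/sep => //.
by apply: subsetP dc; apply: ball_leq; lia.
Qed.

Lemma short_burning k :
  24 * n <= k ^ 2 * delta.+1 -> exists2 s, burning_sequence e s & size s <= k.
Proof.
move=> hk; pose v0 : 'I_n := Ordinal e_conn.1.
have nd : delta < n.
  by apply: leq_trans (card_ball1 v0) _; rewrite -[leqRHS]card_ord max_card.
(* Since [delta < n], the hypothesis forces [24 <= k ^ 2]. *)
have k5 : 4 < k by rewrite ltnNge; apply/negP=> k4; have := leq_sqr k 4; nia.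
(* Were [#|C| + (6 q + 2) > k], the packing bound would give
   [x (2 k + 10 - x) <= k ^ 2] for [x = 12 q + 12]; the left side is maximal at
   [x = k + 5], and [q] is chosen so that [x] is within 6 of that. *)
pose q := (k.-1 %/ 12).
have hq : 12 * q < k <= 12 * q.+1 by rewrite /q; lia.
have [C sepC covC] := separated_cover (6 * q).+2.
have hC : #|C| + (6 * q).+2 <= k.
  (* With at most one centre the claim is [6 q + 3 <= k], which follows from [12 q < k] and
     [4 < k]. *)
  have [C2|C1] := ltnP 1 #|C|; last by lia.
  have := separated_card sepC C2 => hn.
  have {hn} : 24 * (#|C| * q.+1) <= k ^ 2.
    by rewrite -(leq_pmul2r (ltn0Sn delta)); apply: leq_trans hk; lia.
  nia.
(* The copies of [v0] only fill the waiting rounds; any vertex would do. *)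
exists (enum C ++ nseq (6 * q).+2 v0); last by rewrite size_cat -cardE size_nseq.
apply/eqP; rewrite eqEsubset subsetT; apply/subsetP=> v _.
have [c cC vc] := covC v; move: cC; rewrite -mem_enum.
case/splitPr=> s1 s2; rewrite -catA cat_cons; apply: (subsetP (burned_ball _ _ _)).
by apply: subsetP vc; apply: ball_leq; rewrite size_cat size_nseq leq_addl.
Qed.

End Balls.

(** The ceiling is itself a natural number [k] with [24 n <= k ^ 2 (d + 1)], so the hypothesis
    applies to it. *)
Lemma ceil_sqrt_le (R : realType) (n d m : nat) :
  (forall k, 24 * n <= k ^ 2 * d.+1 -> m <= k) ->
  (m%:Z <= Num.ceil (Num.sqrt (24 * n%:R / (d + 1)%:R : R)))%R.
Proof.
move=> hm; set x : R := (_ / _)%R.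
have c0 : (0 <= Num.ceil (Num.sqrt x))%R by rewrite -(ceil0 R) le_ceil // sqrtr_ge0.
rewrite -(gez0_abs c0) lez_nat; apply: hm; set k := `|_|%N.
have hk : (Num.sqrt x <= k%:R)%R.
  by rewrite /k natr_absz ger0_norm // ceil_ge.
have : (x <= (k ^ 2)%:R)%R.
  by rewrite -(@ler_sqrt R) ?ler0n // natrX sqrtr_sqr ger0_norm ?ler0n.
rewrite /x addn1 ler_pdivrMr ?ltr0Sn // -natrM -natrM ler_nat; exact.
Qed.

(** * Compiling fold programs to WHILE *)

Inductive term : Type :=
  | TVar of nat
  | TConst of data
  | TCons of term & term
  | THd of term
  | TTl of term
  | TEq of term & term
  | TIf of term & term & term
  | TFold of term & term & term.

Fixpoint dfold (f : data -> data -> data) (acc l : data) : data :=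
  if l is Cons h t then dfold f (f acc h) t else acc.

(* Environments are lists indexed by de Bruijn indices; the body of a fold sees
   the current element at index 0 and the accumulator at index 1. *)
Fixpoint denote (env : data) (t : term) : data :=
  match t with
  | TVar k => hd (iter k tl env)
  | TConst d => d
  | TCons a b => Cons (denote env a) (denote env b)
  | THd a => hd (denote env a)
  | TTl a => tl (denote env a)
  | TEq a b => data_bool (data_eqb (denote env a) (denote env b))
  | TIf c a b => if truthy (denote env c) then denote env a else denote env b
  | TFold l a b =>
      dfold (fun acc h => denote (Cons h (Cons acc env)) b)
            (denote env a) (denote env l)
  end.

Local Notation env := (Var 0).
Local Notation stack := (Var 1).
Local Notation set_env := (Assign 0).
Local Notation set_stack := (Assign 1).
Local Notation top := (Hd stack).
Local Notation pop := (Tl stack).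

(** Variable 0 holds the environment and variable 1 a stack; the code of [t] pushes the value of [t]
    and restores the environment. A fold keeps the rest of its list on top of the stack, with the
    accumulator just below. *)
Fixpoint compile (t : term) : cmd :=
  match t with
  | TVar k => set_stack (ConsE (Hd (iter k Tl env)) stack)
  | TConst d => set_stack (ConsE (Const d) stack)
  | TCons a b =>
      Seq (compile a) (Seq (compile b)
        (set_stack (ConsE (ConsE (Hd pop) top) (Tl pop))))
  | THd a => Seq (compile a) (set_stack (ConsE (Hd top) pop))
  | TTl a => Seq (compile a) (set_stack (ConsE (Tl top) pop))
  | TEq a b =>
      Seq (compile a) (Seq (compile b)
        (set_stack (ConsE (EqE (Hd pop) top) (Tl pop))))
  | TIf c a b =>
      Seq (compile c)
        (If top (Seq (set_stack pop) (compile a)) (Seq (set_stack pop) (compile b)))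
  | TFold l a b =>
      Seq (compile a) (Seq (compile l) (Seq
        (While top
           (Seq (set_env (ConsE (Hd top) (ConsE (Hd pop) env)))
           (Seq (set_stack (ConsE (Tl top) (Tl pop)))
           (Seq (compile b)
           (Seq (set_env (Tl (Tl env)))
                (set_stack (ConsE (Hd pop) (ConsE top (Tl pop)))))))))
        (set_stack pop)))
  end.

(** Only the two variables in use are recorded, so final stores need not be described as
    functions. *)
Definition runs (C : cmd) (st : store) (d0 d1 : data) : Prop :=
  exists st', [/\ exec C st st', st' 0 = d0 & st' 1 = d1].

Lemma runs_env E st : runs (set_env E) st (eval st E) (st 1).
Proof. by eexists; split; first exact: exec_assign. Qed.

Lemma runs_stack E st : runs (set_stack E) st (st 0) (eval st E).
Proof. by eexists; split; first exact: exec_assign. Qed.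

Lemma runs_seq C1 C2 st a b c d :
  runs C1 st a b -> (forall st', st' 0 = a -> st' 1 = b -> runs C2 st' c d) ->
  runs (Seq C1 C2) st c d.
Proof.
move=> [st1 [x1 H0 H1]] /(_ st1 H0 H1)[st2 [x2 K0 K1]].
by exists st2; split=> //; apply: exec_seq x1 x2.
Qed.

Lemma runs_compile t st : runs (compile t) st (st 0) (Cons (denote (st 0) t) (st 1)).
Proof.
elim: t st => /=.
- move=> k st; rewrite -/(eval st (Var 0)).
  suff -> : iter k tl (eval st env) = eval st (iter k Tl env) by apply: runs_stack.
  by elim: k => //= k ->.
- by move=> d st; apply: runs_stack.
- move=> a IHa b IHb st; apply: runs_seq (IHa st) _ => s1 A0 A1.
  apply: runs_seq (IHb s1) _ => s2; rewrite A0 A1 => B0 B1.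
  by have := runs_stack (ConsE (ConsE (Hd pop) top) (Tl pop)) s2; rewrite /= B0 B1.
- move=> a IHa st; apply: runs_seq (IHa st) _ => s1 A0 A1.
  by have := runs_stack (ConsE (Hd top) pop) s1; rewrite /= A0 A1.
- move=> a IHa st; apply: runs_seq (IHa st) _ => s1 A0 A1.
  by have := runs_stack (ConsE (Tl top) pop) s1; rewrite /= A0 A1.
- move=> a IHa b IHb st; apply: runs_seq (IHa st) _ => s1 A0 A1.
  apply: runs_seq (IHb s1) _ => s2; rewrite A0 A1 => B0 B1.
  by have := runs_stack (ConsE (EqE (Hd pop) top) (Tl pop)) s2; rewrite /= B0 B1.
- move=> c IHc a IHa b IHb st; apply: runs_seq (IHc st) _ => s1 A0 A1.
  have [tc|fc] := boolP (truthy (denote (st 0) c)).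
    have [s2 [x2 B0 B1]] : runs (Seq (set_stack pop) (compile a)) s1
        (st 0) (Cons (denote (st 0) a) (st 1)).
      apply: runs_seq (runs_stack _ _) _ => s2 B0; rewrite /= A1 => B1.
      by have := IHa s2; rewrite B0 B1 A0.
    by exists s2; split=> //; apply: exec_if_true; rewrite //= A1.
  have [s2 [x2 B0 B1]] : runs (Seq (set_stack pop) (compile b)) s1
      (st 0) (Cons (denote (st 0) b) (st 1)).
    apply: runs_seq (runs_stack _ _) _ => s2 B0; rewrite /= A1 => B1.
    by have := IHb s2; rewrite B0 B1 A0.
  by exists s2; split=> //; apply: exec_if_false; rewrite //= A1.
- move=> l IHl a IHa b IHb st; apply: runs_seq (IHa st) _ => s1 A0 A1.
  apply: runs_seq (IHl s1) _ => s2; rewrite A0 A1 => B0 B1.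
  set f := fun acc h => _.
  (* The loop ends with the exhausted list [Nil] above the final accumulator; the last command pops
     it. *)
  apply: (@runs_seq _ _ _ (st 0)
      (Cons Nil (Cons (dfold f (denote (st 0) a) (denote (st 0) l)) (st 1)))); last first.
    by move=> s3 C0 C1; have := runs_stack pop s3; rewrite /= C0 C1.
  elim: (denote (st 0) l) (denote (st 0) a) s2 B0 B1 => [|h _ t IHt] acc s2 B0 B1 /=.
    by exists s2; split=> //; apply: exec_while_false; rewrite /= B1.
  set body := Seq (Assign 0 _) _.
  have [s3 [x3 C0 C1]] : runs body s2 (st 0) (Cons t (Cons (f acc h) (st 1))).
    apply: runs_seq (runs_env _ _) _ => s3; rewrite /= B0 B1 => C0 C1.
    apply: runs_seq (runs_stack _ _) _ => s4; rewrite /= C1 /= C0 => D0 D1.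
    apply: runs_seq (IHb s4) _ => s5; rewrite D0 D1 => E0 E1.
    apply: runs_seq (runs_env _ _) _ => s6; rewrite /= E0 E1 => F0 F1.
    by have := runs_stack (ConsE (Hd pop) (ConsE top (Tl pop))) s6; rewrite /= F1 F0.
  have [s4 [x4 D0 D1]] := IHt _ _ C0 C1.
  by exists s4; split=> //; apply: exec_while_true x3 x4; rewrite /= B1.
Qed.

(** The loop state is the whole environment: the values of [init] and [step] replace it. The input
    is first wrapped in a list, so that [init] reads it at index 0. *)
Definition search (init continue step result : term) : cmd :=
  Seq (set_env (ConsE env (Const Nil)))
  (Seq (compile init)
  (Seq (set_env top)
  (Seq (compile continue)
  (Seq (While top (Seq (compile step) (Seq (set_env top) (compile continue))))
  (Seq (compile result) (set_env top)))))).

Lemma exec_runs_seq C1 C2 st a b v :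
  runs C1 st a b ->
  (forall st', st' 0 = a -> st' 1 = b -> exists2 st'', exec C2 st' st'' & st'' 0 = v) ->
  exists2 st'', exec (Seq C1 C2) st st'' & st'' 0 = v.
Proof.
move=> [st1 [x1 H0 H1]] /(_ st1 H0 H1)[st2 x2 P2].
by exists st2 => //; apply: exec_seq x1 x2.
Qed.

Lemma search_outputs init continue step result k input
    (x := fun j => iter j (denote^~ step) (denote (Cons input Nil) init)) :
  (forall j, j < k -> truthy (denote (x j) continue)) ->
  ~~ truthy (denote (x k) continue) ->
  outputs (search init continue step result) input (denote (x k) result).
Proof.
move=> go stop; rewrite /outputs /search.
(* [i] passes are done and [j] remain. The stack below the test is arbitrary, because each pass
   leaves old values there. *)
have loop i j s d : i + j = k -> s 0 = x i -> s 1 = Cons (denote (x i) continue) d ->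
  exists d', runs (While top (Seq (compile step) (Seq (set_env top) (compile continue)))) s
    (x k) d'.
  elim: j i s d => [|j IH] i s d ijk S0 S1.
    rewrite addn0 in ijk; rewrite -ijk in stop *.
    by exists (s 1), s; split=> //; apply: exec_while_false; rewrite /= S1.
  have [s1 [x1 A0 A1]] : runs (Seq (compile step) (Seq (set_env top) (compile continue))) s
      (x i.+1) (Cons (denote (x i.+1) continue)
                     (Cons (x i.+1) (Cons (denote (x i) continue) d))).
    apply: runs_seq (runs_compile _ _) _ => s1; rewrite S0 S1 => A0 A1.
    apply: runs_seq (runs_env _ _) _ => s2; rewrite /= A1 => B0 B1.
    by have := runs_compile continue s2; rewrite B0 B1.
  rewrite -addSnnS in ijk; have [d' [s2 [x2 B0 B1]]] := IH _ _ _ ijk A0 A1.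
  exists d', s2; split=> //; apply: exec_while_true x1 x2; rewrite /= S1 /=.
  by apply: go; rewrite -ijk leq_addr.
apply: exec_runs_seq (runs_env _ _) _ => s1; rewrite /= => A0 A1.
apply: exec_runs_seq (runs_compile _ _) _ => s2; rewrite A0 A1 => B0 B1.
apply: exec_runs_seq (runs_env _ _) _ => s3; rewrite /= B1 /= => C0 C1.
apply: exec_runs_seq (runs_compile _ _) _ => s4; rewrite C0 C1 => D0 D1.
have [d L] := loop 0 k s4 _ (add0n k) D0 D1.
apply: exec_runs_seq L _ => s5 E0 E1.
apply: exec_runs_seq (runs_compile _ _) _ => s6; rewrite E0 E1 => F0 F1.
by have [s7 [x7 G0 G1]] := runs_env top s6; exists s7 => //; rewrite G0 /= F1.
Qed.

(** * The exhaustive search *)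

Definition tnil : term := TConst Nil.
Definition ttrue : term := TConst (data_bool true).

(* [x] is read inside the fold, hence under two more binders than [B]. *)
Definition mem_term (x B : term) : term :=
  TFold B tnil (TIf (TEq (TVar 0) x) ttrue (TVar 1)).

(* [i] is the index of the activators, [j] that of the list of edges. *)
Definition burned_term (i j : nat) : term :=
  TFold (TVar i) tnil
    (TFold (TVar j.+2) (TCons (TVar 0) (TVar 1))
      (TIf (mem_term (THd (TVar 2)) (TVar 3)) (TCons (TTl (TVar 0)) (TVar 1)) (TVar 1))).

(* Environment: candidate, accumulator, edges, vertices, candidates. *)
Definition covers_term : term :=
  TFold (TVar 3) ttrue (TIf (mem_term (TVar 2) (burned_term 2 4)) (TVar 1) tnil).

(* Environment of the main loop: edges, vertices, candidates. *)
Definition found_term : term :=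
  TFold (TVar 2) tnil (TIf covers_term (TVar 0) (TVar 1)).

(** [Nil] encodes both failure and the empty sequence; the two never clash, as the empty sequence
    burns no nonempty graph. *)
Definition continue_term : term := TEq found_term tnil.

Definition extend_term : term :=
  TFold (TVar 1) tnil
    (TFold (TVar 4) (TVar 1) (TCons (TCons (TVar 2) (TVar 0)) (TVar 1))).

Definition step_term : term :=
  TCons (TVar 0) (TCons (TVar 1) (TCons extend_term tnil)).

(* Accumulator: number of the current column, edges read so far. *)
Definition row_term : term :=
  TFold (TVar 0) (TCons tnil (THd (TTl (TVar 1))))
    (TCons (TCons tnil (THd (TVar 1)))
      (TIf (TVar 0) (TCons (TCons (THd (TVar 3)) (THd (TVar 1))) (TTl (TVar 1)))
                    (TTl (TVar 1)))).

(* Accumulator: number of the current row, edges and vertices read so far. *)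
Definition scan_term : term :=
  TFold (TVar 0) (TCons tnil (TCons tnil tnil))
    (TCons (TCons tnil (THd (TVar 1)))
      (TCons (TTl row_term) (TCons (THd (TVar 1)) (TTl (TTl (TVar 1)))))).

Definition init_term : term :=
  TCons (THd (TTl scan_term))
    (TCons (TTl (TTl scan_term)) (TCons (TConst (Cons Nil Nil)) tnil)).

Definition shortest_burning : cmd :=
  search init_term continue_term step_term found_term.

(** * Denotations of the search terms *)

Lemma data_eqbE a b : reflect (a = b) (data_eqb a b).
Proof.
elim: a b => [|a1 IH1 a2 IH2] [|b1 b2] /=; try by constructor.
apply: (iffP andP) => [[/IH1-> /IH2->] //|[<- <-]].
by split; [apply/IH1 | apply/IH2].
Qed.

Lemma data_nat_inj : injective data_nat.
Proof. by elim=> [|k IH] [|l] //= [/IH->]. Qed.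

Lemma truthy_bool b : truthy (data_bool b) = b.
Proof. by case: b. Qed.

(** This turns a fold over encoded data into [foldl] over the encoded objects, once the body is
    known to respect the encodings. *)
Lemma dfold_code (T U : Type) (cT : T -> data) (cU : U -> data) f g u xs :
  (forall u x, f (cU u) (cT x) = cU (g u x)) ->
  dfold f (cU u) (data_list (map cT xs)) = cU (foldl g u xs).
Proof. by move=> fg; elim: xs u => //= x xs IH u; rewrite fg IH. Qed.

Section Program.

Variables (n : nat) (e : rel 'I_n).

Local Notation vertex := (fun v : 'I_n => data_nat (val v)).

Definition data_edges (es : seq ('I_n * 'I_n)) : data :=
  data_list [seq Cons (vertex p.1) (vertex p.2) | p <- es].

Definition data_state es (vs : seq 'I_n) (L : seq (seq 'I_n)) : data :=
  Cons (data_edges es)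
    (Cons (data_vertices vs) (Cons (data_list (map (@data_vertices n) L)) Nil)).

(** Membership is tested in the old [B], not in [B'], so vertices burned in this round, [a]
    included, do not spread fire before the next. *)
Definition spread (es : seq ('I_n * 'I_n)) (B : seq 'I_n) (a : 'I_n) : seq 'I_n :=
  foldl (fun B' p => if p.1 \in B then p.2 :: B' else B') (a :: B) es.

Definition covers es (vs s : seq 'I_n) : bool :=
  all (mem (foldl (spread es) [::] s)) vs.

Definition found es vs (L : seq (seq 'I_n)) : seq 'I_n :=
  foldl (fun r s => if covers es vs s then s else r) [::] L.

Definition extend (vs : seq 'I_n) (L : seq (seq 'I_n)) : seq (seq 'I_n) :=
  foldl (fun acc v => foldl (fun acc s => (v :: s) :: acc) acc L) [::] vs.

Definition edges : seq ('I_n * 'I_n) :=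
  foldl (fun E u => foldl (fun E v => if e u v then (u, v) :: E else E) E (enum 'I_n))
    [::] (enum 'I_n).

Definition vertices : seq 'I_n := rev (enum 'I_n).

Lemma denote_mem env x B v vs :
  denote env B = data_vertices vs ->
  (forall h r, denote (Cons h (Cons r env)) x = vertex v) ->
  denote env (mem_term x B) = data_bool (v \in vs).
Proof.
move=> hB hx; rewrite /mem_term /= hB -[Nil]/(data_bool false).
rewrite (dfold_code (g := fun b u => (u == v) || b)); last first.
  move=> b u; rewrite hx truthy_bool.
  have -> : data_eqb (vertex u) (vertex v) = (u == v).
    by apply/data_eqbE/eqP => [/data_nat_inj/val_inj|->].
  by case: (u == v).
congr data_bool; rewrite -[RHS]orbF; elim: vs {hB} false => //= u vs IH b.
by rewrite IH inE (eq_sym v) orbA (orbC (v \in vs)).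
Qed.

Opaque mem_term.

Lemma denote_burned env i j s es :
  hd (iter i tl env) = data_vertices s -> hd (iter j tl env) = data_edges es ->
  denote env (burned_term i j) = data_vertices (foldl (spread es) [::] s).
Proof.
move=> hs hj; rewrite /burned_term /= hs.
apply: (dfold_code (cU := @data_vertices n) [::]) => B a.
rewrite -!iterS !iterSr /= hj.
apply: (dfold_code (cU := @data_vertices n) (a :: B)) => B' p.
rewrite /= (@denote_mem _ _ _ p.1 B) // truthy_bool.
by case: ifP.
Qed.

Opaque burned_term.

Lemma denote_covers s r es vs L :
  denote (Cons (data_vertices s) (Cons r (data_state es vs L))) covers_term =
  data_bool (covers es vs s).
Proof.
rewrite /covers_term /= -[Cons Nil Nil]/(data_bool true).
rewrite (dfold_code (g := fun ok v => (v \in foldl (spread es) [::] s) && ok)).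
  congr data_bool; rewrite /covers -[RHS]andbT.
  by elim: vs true => //= v vs IH ok; rewrite IH andbA [_ && (v \in _)]andbC.
move=> ok v; rewrite /=
  (@denote_mem _ _ _ v (foldl (spread es) [::] s)) ?truthy_bool //.
  by case: (v \in _).
exact: denote_burned.
Qed.

Opaque covers_term.

Lemma denote_found es vs L :
  denote (data_state es vs L) found_term = data_vertices (found es vs L).
Proof.
rewrite /found_term /= -[Nil in LHS]/(@data_vertices n [::]).
apply: dfold_code => r s; rewrite /=.
by rewrite denote_covers truthy_bool; case: ifP.
Qed.

Opaque found_term.

Lemma denote_continue es vs L :
  truthy (denote (data_state es vs L) continue_term) = (found es vs L == [::]).
Proof.
rewrite /= denote_found truthy_bool.
by case: (found es vs L).
Qed.

Lemma denote_step es vs L :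
  denote (data_state es vs L) step_term = data_state es vs (extend vs L).
Proof.
rewrite /= /data_state; do 3 congr Cons.
apply: (dfold_code (cU := fun L => data_list (map (@data_vertices n) L)) [::]) => acc v.
exact: (dfold_code (cU := fun L => data_list (map (@data_vertices n) L))).
Qed.

(* The counter of a fold over consecutive vertices is the vertex being read. *)
Lemma dfold_counter (U : Type) (cT : 'I_n -> data) (cU : U -> data) f g u :
  (forall u v, f (Cons (vertex v) (cU u)) (cT v) =
               Cons (Cons Nil (vertex v)) (cU (g u v))) ->
  dfold f (Cons Nil (cU u)) (data_list (map cT (enum 'I_n))) =
  Cons (data_nat n) (cU (foldl g u (enum 'I_n))).
Proof.
(* Generalised to a run of consecutive vertices starting at [k], as the induction consumes the
   enumeration from the left. *)
move=> fg; have gen k s w : map val s = iota k (size s) ->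
    dfold f (Cons (data_nat k) (cU w)) (data_list (map cT s)) =
    Cons (data_nat (k + size s)) (cU (foldl g w s)).
  elim: s k w => [|v s IH] k w /=; first by rewrite addn0.
  by case=> <- hs; rewrite fg -addSnnS -IH.
have := gen 0 (enum 'I_n) u; rewrite size_enum_ord val_enum_ord; exact.
Qed.

Lemma denote_row u E r env :
  denote (Cons (data_list [seq data_bool (e u v) | v <- enum 'I_n])
               (Cons (Cons (vertex u) (Cons (data_edges E) r)) env)) row_term =
  Cons (data_nat n)
    (data_edges (foldl (fun E v => if e u v then (u, v) :: E else E) E (enum 'I_n))).
Proof.
by apply: (dfold_counter (cU := data_edges)) => E' v /=; case: (e u v).
Qed.

Opaque row_term.

Lemma denote_scan :
  denote (Cons (data_graph e) Nil) scan_term =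
  Cons (data_nat n) (Cons (data_edges edges) (data_vertices vertices)).
Proof.
rewrite /scan_term /=.
pose cU (p : seq ('I_n * 'I_n) * seq 'I_n) := Cons (data_edges p.1) (data_vertices p.2).
pose row E u := foldl (fun E v => if e u v then (u, v) :: E else E) E (enum 'I_n).
rewrite -[Cons Nil Nil]/(cU ([::], [::])).
rewrite (dfold_counter (g := fun p u => (row p.1 u, u :: p.2))); last first.
  by move=> [E vs] u; rewrite /= denote_row.
have gen s E vs : foldl (fun p u => (row p.1 u, u :: p.2)) (E, vs) s =
    (foldl row E s, catrev s vs) by elim: s E vs => //= u s IH E vs; rewrite IH.
by rewrite gen.
Qed.

Opaque scan_term.

Lemma denote_init :
  denote (Cons (data_graph e) Nil) init_term = data_state edges vertices [:: [::]].
Proof. by rewrite /= denote_scan. Qed.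

(** * Graph-theoretic meaning of the list computations *)

Lemma mem_foldl_edges (s : seq 'I_n) u E a b :
  ((a, b) \in foldl (fun E v => if e u v then (u, v) :: E else E) E s) =
  [&& a == u, b \in s & e a b] || ((a, b) \in E).
Proof.
elim: s E => [|v s IH] E /=; rewrite ?andbF // IH.
have -> : ((a, b) \in if e u v then (u, v) :: E else E) =
    [&& a == u, b == v & e a b] || ((a, b) \in E).
  case: ifP => euv; rewrite ?inE ?xpair_eqE; do 2!case: eqP => //= ->;
    by rewrite euv.
by rewrite inE; case: (a == u); case: (b == v); case: (e a b); case: (b \in s).
Qed.

Lemma mem_edges u v : ((u, v) \in edges) = e u v.
Proof.
have gen s E : ((u, v) \in foldl (fun E u => foldl (fun E v =>
    if e u v then (u, v) :: E else E) E (enum 'I_n)) E s) =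
    (u \in s) && e u v || ((u, v) \in E).
  elim: s E => //= w s IH E; rewrite IH mem_foldl_edges mem_enum in_cons /=.
  by case: (u == w); case: (u \in s); case: (e u v).
by rewrite /edges gen mem_enum orbF.
Qed.

Lemma mem_extend vs L t :
  (t \in extend vs L) = if t is v :: s then (v \in vs) && (s \in L) else false.
Proof.
have inner w acc : (t \in foldl (fun acc s => (w :: s) :: acc) acc L) =
    (if t is v :: s then (v == w) && (s \in L) else false) || (t \in acc).
  elim: L acc => [|s L IH] acc /=; first by case: t => // v s; rewrite andbF.
  rewrite IH in_cons; case: t {IH} => [|v s'] //=; rewrite in_cons eqseq_cons.
  by case: (v == w); case: (s' == s); case: (s' \in L).
have outer acc : (t \in foldl (fun acc v => foldl (fun acc s => (v :: s) :: acc) acc L) acc vs) =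
    (if t is v :: s then (v \in vs) && (s \in L) else false) || (t \in acc).
  elim: vs acc => [|w vs IH] acc /=; first by case: t {inner}.
  rewrite IH inner; case: t {inner IH} => //= v s; rewrite in_cons.
  by case: (v == w); case: (s \in L); case: (v \in vs).
by rewrite /extend outer orbF.
Qed.

(** Pass [k] examines every word of length [k], so the first success has minimal length. *)
Lemma mem_words vs k t : (forall v, v \in vs) ->
  (t \in iter k (extend vs) [:: [::]]) = (size t == k).
Proof.
move=> allv; elim: k t => [|k IH] t; first by rewrite inE size_eq0.
by rewrite iterS mem_extend; case: t => // v s; rewrite allv IH.
Qed.

Lemma mem_spread es B a v : (forall u v, ((u, v) \in es) = e u v) ->
  (v \in spread es B a) = (v \in burn_round e [set x in B] a).
Proof.
move=> ees; rewrite /burn_round !inE.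
have -> : [exists u in [set x in B], e u v] = has (fun p => (p.1 \in B) && (p.2 == v)) es.
  apply/exists_inP/hasP => [[u]|[[u w] /= uw /andP[uB /eqP<-]]].
    by rewrite inE => uB euv; exists (u, v); rewrite ?ees //= uB eqxx.
  by exists u; rewrite ?inE // -ees.
have -> : ((v \in B) || has (fun p => (p.1 \in B) && (p.2 == v)) es || (v == a)) =
    has (fun p => (p.1 \in B) && (p.2 == v)) es || (v \in a :: B).
  by rewrite inE; case: (v == a); case: (v \in B); case: has.
rewrite /spread; elim: es (a :: B) {ees} => //= p es IH B'; rewrite IH.
case: ifP => _ //=; rewrite inE (eq_sym v).
by case: (p.2 == v); case: has.
Qed.

Lemma coversP s : reflect (burning_sequence e s) (covers edges vertices s).
Proof.
have spreadE B : [set x in foldl (spread edges) B s] = foldl (burn_round e) [set x in B] s.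
  elim: s B => //= a s IH B; rewrite IH; congr foldl.
  by apply/setP=> v; rewrite inE mem_spread //; apply: mem_edges.
rewrite /burning_sequence /burned; have -> : set0 = [set x in ([::] : seq 'I_n)].
  by apply/setP=> v; rewrite !inE.
rewrite -spreadE; apply: (iffP allP) => [H|/setP H v _].
  by apply/setP=> v; rewrite !inE; apply: H; rewrite mem_rev mem_enum.
by have := H v; rewrite !inE.
Qed.

Lemma foundP es vs L :
  if has (covers es vs) L then (found es vs L \in L) && covers es vs (found es vs L)
  else found es vs L == [::].
Proof.
(* The fold keeps the last success, hence induction from the right end. *)
rewrite /found; elim/last_ind: L => //= L s IH.
rewrite has_rcons foldl_rcons mem_rcons in_cons; case: (boolP (covers es vs s)) => /= [cs|_].
  by rewrite eqxx.
by case: ifP IH => // _ /andP[-> ->]; rewrite orbT.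
Qed.

Lemma shortest_burning_outputs s0 : 0 < n -> burning_sequence e s0 ->
  exists s, [/\ outputs shortest_burning (data_graph e) (data_vertices s),
                burning_sequence e s
              & forall t, burning_sequence e t -> size s <= size t].
Proof.
move=> n0 bs0; have allv v : v \in vertices by rewrite mem_rev mem_enum.
pose W k := iter k (extend vertices) [:: [::]].
pose P k := has (covers edges vertices) (W k).
have Ps t : burning_sequence e t -> P (size t).
  by move=> bt; apply/hasP; exists t; [rewrite mem_words | apply/coversP].
case: (ex_minnP (ex_intro P _ (Ps _ bs0))) => k Pk mink.
have := foundP edges vertices (W k); rewrite -/(P k) Pk => /andP[].
set s := found _ _ _; rewrite mem_words // => /eqP sk /coversP bs.
exists s; split=> // [|t /Ps/mink]; last by rewrite sk.
have stateE j : iter j (denote^~ step_term)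
    (denote (Cons (data_graph e) Nil) init_term) = data_state edges vertices (W j).
  by elim: j => [|j IH]; [exact: denote_init | rewrite iterS IH denote_step].
rewrite /s -denote_found -stateE; apply: search_outputs => [j jk|]; rewrite stateE denote_continue.
  by have := foundP edges vertices (W j); case: ifP => // /mink; rewrite leqNgt jk.
(* At [k] the loop does stop: [s] burns a nonempty graph, so it is not the failure value. *)
rewrite -/s; apply/eqP=> s_nil; move: bs; rewrite s_nil => /setP/(_ (Ordinal n0)).
by rewrite !inE.
Qed.

End Program.

Local Open Scope ring_scope.

Theorem theorem1 :
  exists algorithm : cmd,
    forall (n delta : nat) (e : rel 'I_n),
      symmetric e -> irreflexive e ->
      connected_graph e -> is_min_degree e delta ->
      exists s : seq 'I_n,
        [/\ outputs algorithm (data_graph e) (data_vertices s),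
            burning_sequence e s
          & forall R : realType,
              ((size s)%:Z <=
                 Num.ceil (Num.sqrt (24 * n%:R / (delta + 1)%:R : R)))%R].
Proof.
exists shortest_burning => n delta e e_sym e_irr e_conn [_ e_deg].
have short := short_burning e_sym e_irr e_conn e_deg.
(* A crude length, [24 n], already yields some burning sequence, which guarantees that the search
   terminates. *)
have enough : (24 * n <= (24 * n) ^ 2 * delta.+1)%N.
  by rewrite -mulnn -mulnA leq_pmulr // !muln_gt0 e_conn.1.
have [s0 bs0 _] := short _ enough.
have [s [outs bs mins]] := shortest_burning_outputs e_conn.1 bs0.
(* By minimality [s] is within every admissible [k] at once, so one [s] serves all real fields
   [R]. *)
exists s; split=> // R; apply: ceil_sqrt_le => k /short[t /mins st].
exact: leq_trans st.
Qed.
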